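(* If $(\mathbf{x}^*,\mathbf{u}^* )\in\mathbb{R}^{n}\times\mathbb{R}^m$ is a local minimizer of the primal problem $$\min_{\mathbf{x},\mathbf{u}}\ f(\mathbf{x})+\mathcal{I}(\mathbf{u})\quad\text{s.t.}\quad A\mathbf{x}+\mathbf{b}=\mathbf{u}$$ with associated multiplier $\mathbf{z}^*\in\mathbb{R}^m$, then $\mathbf{z}^*$ is a local minimizer of the dual problem $$\min_{\mathbf{z}\in\mathbb{R}^m}\ F(\mathbf{z}):=h(\mathbf{z})+g(\mathbf{z}).$$ Conversely, if $\mathbf{z}^*$ is a local minimizer of the dual problem, then $(\mathbf{x}^*,\mathbf{u}^* ):=(\nabla f^*(-A^\top\mathbf{z}^* ),\,-\nabla h(\mathbf{z}^* ))$ is a local minimizer of the primal problem.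
   Context: Setting: $f:\mathbb{R}^n\to\mathbb{R}$ is $\sigma_f$-strongly convex for some $\sigma_f>0$ (possibly nonsmooth), i.e. $f(s\mathbf{x}+(1-s)\mathbf{y})\le sf(\mathbf{x})+(1-s)f(\mathbf{y})-\frac{\sigma_f}{2}s(1-s)\|\mathbf{x}-\mathbf{y}\|^2$ for all $\mathbf{x},\mathbf{y}$ and $s\in[0,1]$; $A\in\mathbb{R}^{m\times n}$, $\mathbf{b}\in\mathbb{R}^m$; $\lambda>0$, $\mu>0$ are constants. $\mathcal{I}(\mathbf{u})=\lambda\sum_{i=1}^m\mathbf{1}_{(0,\infty)}(u_i)$, where $\mathbf{1}_{(0,\infty)}(t)=1$ if $t>0$ and $0$ if $t\le 0$. $f^*(\mathbf{v})=\sup_{\mathbf{x}}\{\langle\mathbf{v},\mathbf{x}\rangle-f(\mathbf{x})\}$ is the conjugate function (it is finite and differentiable with $\frac{1}{\sigma_f}$-Lipschitz gradient). $h(\mathbf{z}):=f^*(-A^\top\mathbf{z})-\langle\mathbf{b},\mathbf{z}\rangle$, so $-\nabla h(\mathbf{z})=A\nabla f^*(-A^\top\mathbf{z})+\mathbf{b}$. $g(\mathbf{z}):=\mu\|\mathbf{z}\|_0+\delta_+(\mathbf{z})$, where $\|\mathbf{z}\|_0$ is the number of nonzero entries and $\delta_+(\mathbf{z})=0$ if $\mathbf{z}\ge 0$ componentwise, $+\infty$ otherwise. For a function $\varphi:\mathbb{R}^m\to(-\infty,\infty]$, the regular subdifferential at $\bar{\mathbf{z}}$ with $\varphi(\bar{\mathbf{z}})<\infty$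 is $\widehat\partial\varphi(\bar{\mathbf{z}})=\{\mathbf{v}:\liminf_{\mathbf{z}\to\bar{\mathbf{z}},\mathbf{z}\ne\bar{\mathbf{z}}}\frac{\varphi(\mathbf{z})-\varphi(\bar{\mathbf{z}})-\langle\mathbf{v},\mathbf{z}-\bar{\mathbf{z}}\rangle}{\|\mathbf{z}-\bar{\mathbf{z}}\|}\ge0\}$, and the limiting subdifferential is $\partial\varphi(\bar{\mathbf{z}})=\{\mathbf{v}:\exists\,\mathbf{z}^k\to\bar{\mathbf{z}},\ \varphi(\mathbf{z}^k)\to\varphi(\bar{\mathbf{z}}),\ \widehat\partial\varphi(\mathbf{z}^k)\ni\mathbf{v}^k\to\mathbf{v}\}$ (for convex $f$ it is the usual convex subdifferential). For $\mathcal{I}$ it takes the form $\partial\mathcal{I}(\mathbf{u})=\{\mathbf{v}: v_i\ge0\text{ if }u_i=0,\ v_i=0\text{ if }u_i\neq0,\ i=1,\dots,m\}$. Associated multiplier: $\mathbf{z}^*$ is a multiplier associated with $(\mathbf{x}^*,\mathbf{u}^* )$ if the KKT system holds: $0\in\partial f(\mathbf{x}^* )+A^\top\mathbf{z}^*$, $\ \mathbf{z}^*\in\partial\mathcal{I}(\mathbf{u}^* )$, $\ A\mathbf{x}^*+\mathbf{b}-\mathbf{u}^*=0$. A local minimizer of the extended-valued function $F$ is understood as a point $\mathbf{z}^*$ with $F(\mathbf{z}^* )<\infty$ (i.e. $\mathbf{z}^*\ge0$) such that $F(\mathbf{z})\ge F(\mathbf{z}^* )$ for all $\mathbf{z}$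 in a neighborhood of $\mathbf{z}^*$. A local minimizer of the primal problem is a feasible point minimizing the objective among feasible points in a neighborhood. *)

(* Defs.v *)
From HB Require Import structures.
From mathcomp Require Import all_boot all_order all_algebra.
From mathcomp Require Import all_classical all_reals all_analysis.

Set Implicit Arguments.
Unset Strict Implicit.
Unset Printing Implicit Defensive.

Import Order.TTheory GRing.Theory Num.Theory.
Import numFieldNormedType.Exports.

Local Open Scope classical_set_scope.
Local Open Scope ring_scope.

Definition dot (R : realType) (n : nat) (x y : 'cV[R]_n) : R :=
  \sum_(i < n) x i ord0 * y i ord0.

(* Euclidean norm; the library's norm `|x| on matrices is the sup norm, which
   is used only through the topology it induces. *)
Definition enorm (R : realType) (n : nat) (x : 'cV[R]_n) : R :=
  Num.sqrt (dot x x).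

Definition strongly_convex (R : realType) (n : nat) (sigma : R)
    (f : 'cV[R]_n -> R) : Prop :=
  forall (x y : 'cV[R]_n) (s : R), 0 <= s <= 1 ->
    f (s *: x + (1 - s) *: y) <=
      s * f x + (1 - s) * f y
      - sigma / 2 * s * (1 - s) * enorm (x - y) ^+ 2.

Definition conjugate (R : realType) (n : nat) (f : 'cV[R]_n -> R)
    (v : 'cV[R]_n) : \bar R :=
  ereal_sup [set (dot v x - f x)%:E | x in [set: 'cV[R]_n]].

(* Column vector representing the Frechet differential of phi at x.  As with
   'd, it is meaningful only where phi is finite near x and differentiable
   at x. *)
Definition gradient (R : realType) (n : nat) (phi : 'cV[R]_n -> \bar R)
    (x : 'cV[R]_n) : 'cV[R]_n :=
  \col_(i < n) 'd (fine \o phi) x (delta_mx i ord0).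

(* The functions phi are meant to take values in (-oo, +oo]. *)
Definition regular_subdiff (R : realType) (n : nat)
    (phi : 'cV[R]_n -> \bar R) (x : 'cV[R]_n) : set 'cV[R]_n :=
  [set v | (phi x < +oo)%E /\
    (0 <= limf_einf
            (fun y : 'cV[R]_n =>
               (phi y - phi x - (dot v (y - x))%:E) * ((enorm (y - x))^-1)%:E)
            (x^'))%E].

Definition limiting_subdiff (R : realType) (n : nat)
    (phi : 'cV[R]_n -> \bar R) (x : 'cV[R]_n) : set 'cV[R]_n :=
  [set v | (phi x < +oo)%E /\
    exists xk vk : nat -> 'cV[R]_n,
      [/\ xk k @[k --> \oo] --> x,
          phi (xk k) @[k --> \oo] --> phi x,
          forall k, regular_subdiff phi (xk k) (vk k) &
          vk k @[k --> \oo] --> v]].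

Definition local_minimizer (R : realType) (T : topologicalType) (S : set T)
    (phi : T -> \bar R) (x : T) : Prop :=
  [/\ S x, (phi x < +oo)%E & \forall y \near x, S y -> (phi x <= phi y)%E].

Definition step_cost (R : realType) (m : nat) (lambda : R) (u : 'cV[R]_m) : R :=
  lambda * \sum_(i < m) \1_(`]0, +oo[ : set R) (u i ord0).

Definition primal_objective (R : realType) (n m : nat) (f : 'cV[R]_n -> R)
    (lambda : R) (p : 'cV[R]_n * 'cV[R]_m) : \bar R :=
  (f p.1 + step_cost lambda p.2)%:E.

Definition primal_feasible (R : realType) (n m : nat) (A : 'M[R]_(m, n))
    (b : 'cV[R]_m) : set ('cV[R]_n * 'cV[R]_m) :=
  [set p | A *m p.1 + b = p.2].

Definition associated_multiplier (R : realType) (n m : nat)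
    (f : 'cV[R]_n -> R) (A : 'M[R]_(m, n)) (b : 'cV[R]_m) (lambda : R)
    (x : 'cV[R]_n) (u z : 'cV[R]_m) : Prop :=
  [/\ [set v + A^T *m z | v in limiting_subdiff (EFin \o f) x] 0,
      limiting_subdiff (EFin \o step_cost lambda) u z &
      A *m x + b - u = 0].

Definition dual_h (R : realType) (n m : nat) (f : 'cV[R]_n -> R)
    (A : 'M[R]_(m, n)) (b z : 'cV[R]_m) : \bar R :=
  (conjugate f (- A^T *m z) - (dot b z)%:E)%E.

Definition l0norm (R : realType) (m : nat) (z : 'cV[R]_m) : nat :=
  #|[pred i : 'I_m | z i ord0 != 0]|.

Definition delta_plus (R : realType) (m : nat) (z : 'cV[R]_m) : \bar R :=
  (if [forall i : 'I_m, (0 <= z i ord0)%R] then 0 else +oo)%E.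

Definition dual_g (R : realType) (m : nat) (mu : R) (z : 'cV[R]_m) : \bar R :=
  ((mu * (l0norm z)%:R)%:E + delta_plus z)%E.

Definition dual_objective (R : realType) (n m : nat) (f : 'cV[R]_n -> R)
    (A : 'M[R]_(m, n)) (b : 'cV[R]_m) (mu : R) (z : 'cV[R]_m) : \bar R :=
  (dual_h f A b z + dual_g mu z)%E.

(* Main.v *)
(* Strong convexity makes f^* finite with an attained supremum: a minimiser of
   x |-> f x - <v, x> is built one coordinate at a time, since partial
   minimisation preserves strong convexity, and on the line it is the supremum
   of the points at which the function still decreases further right.  The
   quadratic growth at that maximiser x bounds
   f^*(w) - f^*(v) - <w - v, x> by |w - v|^2 / sigma, so that x is the gradient
   of f^* at v.

   Both implications then go through the same complementarity condition
   z >= 0, z_i <> 0 -> u_i = 0, where u = A x + b and -A^T z is a subgradient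
   of f at x.  Linearising the convex part, the change of either objective is
   bounded below by a sum over i of one-dimensional terms, in which the jump
   of the discontinuous part (mu or lambda) absorbs (y_i - z_i) u_i, resp.
   (w_i - u_i) z_i, near the given point whenever the linear term does not
   have the right sign. *)

Require Import Defs.
From HB Require Import structures.
From mathcomp Require Import all_boot all_order all_algebra.
From mathcomp Require Import all_classical all_reals all_analysis.
From mathcomp Require Import ring lra.
Import Order.TTheory GRing.Theory Num.Theory.
Import numFieldNormedType.Exports.
Local Open Scope classical_set_scope.
Local Open Scope ring_scope.

(** * The Euclidean inner product *)

Section Dot.
Context {R : realType}.

Lemma dotC {n} (x y : 'cV[R]_n) : dot x y = dot y x.
Proof. by apply: eq_bigr => i _; rewrite mulrC. Qed.

Lemma dotDl {n} (x y z : 'cV[R]_n) : dot (x + y) z = dot x z + dot y z.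
Proof. by rewrite -big_split; apply: eq_bigr => i _; rewrite mxE mulrDl. Qed.

Lemma dotZl {n} a (x y : 'cV[R]_n) : dot (a *: x) y = a * dot x y.
Proof. by rewrite mulr_sumr; apply: eq_bigr => i _; rewrite mxE mulrA. Qed.

Lemma dotNl {n} (x y : 'cV[R]_n) : dot (- x) y = - dot x y.
Proof. by rewrite -scaleN1r dotZl mulN1r. Qed.

Lemma dotBl {n} (x y z : 'cV[R]_n) : dot (x - y) z = dot x z - dot y z.
Proof. by rewrite dotDl dotNl. Qed.

Lemma dotDr {n} (x y z : 'cV[R]_n) : dot x (y + z) = dot x y + dot x z.
Proof. by rewrite dotC dotDl !(dotC x). Qed.

Lemma dotZr {n} a (x y : 'cV[R]_n) : dot x (a *: y) = a * dot x y.
Proof. by rewrite dotC dotZl dotC. Qed.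

Lemma dotNr {n} (x y : 'cV[R]_n) : dot x (- y) = - dot x y.
Proof. by rewrite dotC dotNl dotC. Qed.

Lemma dotBr {n} (x y z : 'cV[R]_n) : dot x (y - z) = dot x y - dot x z.
Proof. by rewrite dotDr dotNr. Qed.

Lemma dot_trmx {m n} (A : 'M[R]_(m, n)) (z : 'cV[R]_m) (x : 'cV[R]_n) :
  dot (A^T *m z) x = dot z (A *m x).
Proof.
rewrite /dot.
under eq_bigr => i _ do rewrite mxE mulr_suml.
under [RHS]eq_bigr => i _ do rewrite mxE mulr_sumr.
rewrite exchange_big; apply: eq_bigr => i _; apply: eq_bigr => j _.
by rewrite mxE; ring.
Qed.

Lemma dot_delta_mx {n} (i : 'I_n) (x : 'cV[R]_n) :
  dot (delta_mx i ord0) x = x i ord0.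
Proof.
rewrite /dot (bigD1 i) //= mxE !eqxx mul1r big1 ?addr0 // => j ji.
by rewrite mxE (negPf ji) mul0r.
Qed.

Lemma dot_ge0 {n} (x : 'cV[R]_n) : 0 <= dot x x.
Proof. by apply: sumr_ge0 => i _; rewrite -expr2 sqr_ge0. Qed.

Lemma enorm_sqr {n} (x : 'cV[R]_n) : enorm x ^+ 2 = dot x x.
Proof. by rewrite sqr_sqrtr ?dot_ge0. Qed.

Lemma enorm_gt0 {n} {x : 'cV[R]_n} : x != 0 -> 0 < enorm x.
Proof.
move=> x0; rewrite sqrtr_gt0 lt_neqAle dot_ge0 andbT eq_sym.
apply: contra x0; rewrite /dot psumr_eq0 => [/allP d0|i _]; last first.
  by rewrite -expr2 sqr_ge0.
apply/eqP/matrixP => i j; rewrite ord1 mxE.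
by have := d0 i (mem_index_enum i); rewrite mulf_eq0 orbb => /eqP.
Qed.

Lemma enormZ {n} (a : R) (x : 'cV[R]_n) : enorm (a *: x) = `|a| * enorm x.
Proof.
by rewrite /enorm dotZl dotZr mulrA -expr2 sqrtrM ?sqr_ge0// sqrtr_sqr.
Qed.

(** Young's inequality, by completing the square in each coordinate. *)
Lemma dot_le_quadratic {n} {a : R} (x y : 'cV[R]_n) : 0 < a ->
  dot x y <= a * dot y y + (4 * a)^-1 * dot x x.
Proof.
move=> a0; rewrite /dot !mulr_sumr -big_split; apply: ler_sum => i _ /=.
set p := x i ord0; set q := y i ord0; rewrite -subr_ge0.
have -> : a * (q * q) + (4 * a)^-1 * (p * p) - p * q
          = a * (q - (2 * a)^-1 * p) ^+ 2 by field; rewrite gt_eqF.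
by rewrite mulr_ge0 ?sqr_ge0 // ltW.
Qed.

Lemma coord_le_norm {n} (x : 'cV[R]_n) i : `|x i ord0| <= `|x|.
Proof.
rewrite [in leRHS]/Num.norm /= mx_normrE.
by apply: (le_trans _ (le_bigmax_cond _ _ (isT : xpredT (i, ord0)))).
Qed.

(** Passes from the Euclidean form to the sup norm: each entry of [A *m x] is at most an absolute
    row sum times [|x|]. *)
Lemma dot_mulmx_le_norm {m n} (A : 'M[R]_(m, n)) :
  exists2 C, 0 <= C &
    forall x : 'cV[R]_n, dot (A *m x) (A *m x) <= C * `|x| ^+ 2.
Proof.
exists (\sum_i (\sum_j `|A i j|) ^+ 2) => [|x].
  by apply: sumr_ge0 => i _; rewrite sqr_ge0.
rewrite mulr_suml; apply: ler_sum => i _.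
have s0 : 0 <= \sum_j `|A i j| by apply: sumr_ge0.
rewrite -expr2 -real_normK ?num_real // -exprMn.
rewrite ler_pXn2r ?nnegrE ?mulr_ge0 // mxE.
apply: le_trans (ler_norm_sum _ _ _) _; rewrite mulr_suml.
by apply: ler_sum => j _; rewrite normrM ler_wpM2l ?coord_le_norm.
Qed.

End Dot.

(** * Minimisers of strongly convex functions *)

Section Minimizer.
Context {R : realType}.

Lemma small_step {a d : R} (B : R) : 0 < a -> 0 < d ->
  exists e, [/\ 0 < e, e < d & e * B < a].
Proof.
move=> a0 d0; have B1 : 0 < `|B| + 1 by rewrite ltr_wpDl.
pose e := Num.min (d / 2) (a / (`|B| + 1)).
exists (e / 2).
have e0 : 0 < e by rewrite lt_min !divr_gt0.
have ed : e <= d / 2 by rewrite ge_min lexx.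
have ea : e * (`|B| + 1) <= a by rewrite -ler_pdivlMr // ge_min lexx orbT.
split; [lra|lra|].
have : e / 2 * B <= e / 2 * `|B| by rewrite ler_pM2l ?ler_norm; lra.
have : 0 <= e * `|B| by rewrite mulr_ge0 // ltW.
lra.
Qed.

Definition strongly_convex1 (c : R) (G : R -> R) :=
  forall t u s : R, 0 <= s <= 1 ->
    G (s * t + (1 - s) * u) <=
      s * G t + (1 - s) * G u - c * s * (1 - s) * (t - u) ^+ 2.

(** Strong convexity at a point [u] between [t] and [v], multiplied by [v - t] to stay free of
    division. *)
Lemma strongly_convex1_chord {c G} {t u v : R} :
  strongly_convex1 c G -> t < u -> u < v ->
  G u * (v - t) <=
    (v - u) * G t + (u - t) * G v - c * (v - u) * (u - t) * (v - t).
Proof.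
move=> Gsc tu uv; have tv : 0 < v - t by lra.
have s01 : 0 <= (v - u) / (v - t) <= 1.
  by rewrite divr_ge0 /= ?ler_pdivrMr; lra.
have := Gsc t v _ s01; rewrite -(ler_pM2r tv).
have -> : (v - u) / (v - t) * t + (1 - (v - u) / (v - t)) * v = u.
  by field; lra.
move=> /le_trans; apply; rewrite le_eqVlt; apply/orP; left; apply/eqP.
by field; lra.
Qed.

Lemma strongly_convex1_opp {c G} :
  strongly_convex1 c G -> strongly_convex1 c (fun t => G (- t)).
Proof.
move=> Gsc t u s s01; have := Gsc (- t) (- u) s s01.
have -> : s * - t + (1 - s) * - u = - (s * t + (1 - s) * u) by ring.
by have -> : (- t - - u) ^+ 2 = (t - u) ^+ 2 by ring.
Qed.

(** The chord through [0], [1] and [t] gives [t * (c * (t - 1) + G 1 - G 0) <= G t - G 0], whose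
    left side is positive for large [t]. *)
Lemma strongly_convex1_coercive {c G} : 0 < c -> strongly_convex1 c G ->
  exists2 T, 0 < T & forall t, T <= t -> G 0 < G t.
Proof.
move=> c0 Gsc; have p0 : 0 <= `|G 1 - G 0| / c by rewrite divr_ge0 // ltW.
exists (2 + `|G 1 - G 0| / c); first lra.
move=> t Tt; have t1 : 1 < t by lra.
have := strongly_convex1_chord Gsc ltr01 t1; rewrite !subr0 !mulr1 mul1r.
have : `|G 1 - G 0| < c * (t - 1) by rewrite mulrC -ltr_pdivrMr //; lra.
have := ler_norm (G 0 - G 1); rewrite distrC => h1 h2.
have : 0 < t * (c * (t - 1) + G 1 - G 0) by rewrite mulr_gt0; lra.
lra.
Qed.

Lemma strongly_convex1_min {c G} : 0 < c -> strongly_convex1 c G ->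
  exists t, forall u, G t <= G u.
Proof.
move=> c0 Gsc.
have [T1 T10 GT1] := strongly_convex1_coercive c0 Gsc.
have [T2 T20] := strongly_convex1_coercive c0 (strongly_convex1_opp Gsc).
rewrite oppr0 => /(_ _ (lexx _)) GT2.
have chord t u v : t < u -> u < v ->
    G u * (v - t) <= (v - u) * G t + (u - t) * G v.
  move=> tu uv; have := strongly_convex1_chord Gsc tu uv.
  have : 0 <= c * (v - u) * (u - t) * (v - t) by rewrite !mulr_ge0; lra.
  lra.
pose D := [set t | exists2 v, t < v & G v < G t].
(* A chord whose right end is a drop must already fall on its left part; hence [D] is closed
   downwards. *)
have Ddown t u : D u -> t < u -> G u < G t.
  move=> [v uv Gvu] tu; have := chord _ _ _ tu uv => ch.
  have : 0 < (v - u) * (G t - G u).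
    have : 0 < (u - t) * (G u - G v) by rewrite mulr_gt0; lra.
    lra.
  by rewrite pmulr_rgt0; lra.
have Dsup : has_sup D.
  split; first by exists (- T2), 0 => //; lra.
  exists T1 => t [v tv Gvt]; rewrite leNgt; apply/negP => T1t.
  have t0 : 0 < t by lra.
  have ch := chord _ _ _ t0 tv; have Gt := GT1 _ (ltW T1t).
  have : 0 < t * (G t - G v) by rewrite mulr_gt0; lra.
  have : 0 < (v - t) * (G t - G 0) by rewrite mulr_gt0; lra.
  lra.
exists (sup D) => u; rewrite leNgt; apply/negP => Gu.
have [us|us|us] := ltgtP u (sup D); last by rewrite us ltxx in Gu.
(* Since [sup D - e] is in [D], [G (sup D - e) < G u]; but the chord ending at [sup D + 1] lets [G]
   rise by less than [G (sup D) - G u] from there to [sup D]. *)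
- have [e [e0 eu eB]] := small_step (G (sup D + 1) - G (sup D))
    (ltac:(lra) : 0 < G (sup D) - G u) (ltac:(lra) : 0 < sup D - u).
  have [d Dd sd] := sup_adherent e0 Dsup.
  have De : D (sup D - e) by exists d => //; apply: Ddown.
  have := chord (sup D - e) (sup D) (sup D + 1) ltac:(lra) ltac:(lra).
  have := Ddown u _ De ltac:(lra).
  lra.
(* Symmetrically, [sup D + e] is outside [D], so [G (sup D + e) <= G u], against the chord starting
   at [sup D - 1]. *)
- have [e [e0 eu eB]] := small_step (G (sup D - 1) - G (sup D))
    (ltac:(lra) : 0 < G (sup D) - G u) (ltac:(lra) : 0 < u - sup D).
  have := chord (sup D - 1) (sup D) (sup D + e) ltac:(lra) ltac:(lra).
  have : G (sup D + e) <= G u.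
    rewrite leNgt; apply/negP => Ge.
    have : sup D + e <= sup D.
      by apply: ub_le_sup; [case: Dsup|exists u => //; lra].
    lra.
  lra.
Qed.

(** Induction on the number [k] of free coordinates, the others being frozen at [x0]. Minimising
    over the first [k] leaves a strongly convex function of the next one. *)
Lemma strongly_convex_slice_min {n} {sigma : R} {f : 'cV[R]_n -> R} :
  0 < sigma -> strongly_convex sigma f ->
  forall (k : nat) (x0 : 'cV[R]_n), exists x : 'cV[R]_n,
    (forall i : 'I_n, (k <= i)%N -> x i ord0 = x0 i ord0) /\
    (forall y : 'cV[R]_n,
      (forall i : 'I_n, (k <= i)%N -> y i ord0 = x0 i ord0) -> f x <= f y).
Proof.
move=> sigma0 fsc; elim=> [|k IH] x0.
  exists x0; split=> // y yx0; rewrite le_eqVlt; apply/orP; left; apply/eqP.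
  by congr f; apply/matrixP => i j; rewrite ord1 yx0.
have [nk|kn] := leqP n k.
  have [x [xx0 xmin]] := IH x0; exists x; split=> [i ki|y yx0].
    by apply: xx0; apply: ltnW.
  by apply: xmin => i ki; move: (leq_trans (ltn_ord i) nk); rewrite ltnNge ki.
pose K := Ordinal kn.
pose X0 t := \col_(i < n) (if i == K then t else x0 i ord0).
have [X XP] := choice (fun t => IH (X0 t)).
have XK t : X t K ord0 = t by rewrite (XP t).1 ?mxE ?eqxx.
have Xx0 t (i : 'I_n) : (k < i)%N -> X t i ord0 = x0 i ord0.
  move=> ki; rewrite (XP t).1 ?(ltnW ki) // mxE ifN //.
  by apply: contraTneq ki => ->; rewrite ltnn.
have split_le (i : 'I_n) : (k <= i)%N -> i = K \/ (k < i)%N.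
  by rewrite leq_eqVlt => /orP[/eqP ki|]; [left; apply: val_inj|right].
have Gsc : strongly_convex1 (sigma / 2) (f \o X).
  move=> t u s s01 /=.
  (* The combination of [X t] and [X u] competes with the minimiser at the combined parameter. *)
  have Xle : f (X (s * t + (1 - s) * u)) <= f (s *: X t + (1 - s) *: X u).
    apply: (XP _).2 => i /split_le[->|ki]; first by rewrite !mxE !XK eqxx.
    rewrite !mxE ifN; last by apply: contraTneq ki => ->; rewrite ltnn.
    by rewrite !Xx0 // -mulrDl addrC subrK mul1r.
  apply: le_trans Xle _; apply: le_trans (fsc _ _ _ s01) _.
  rewrite lerD2l lerN2 ler_wpM2l //.
    by case/andP: s01 => s0 s1; rewrite !mulr_ge0 ?subr_ge0 // ?ltW ?invr_gt0.
  (* Coordinate [K] alone contributes [(t - u) ^+ 2] to the squared distance, so the modulus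
     survives. *)
  rewrite enorm_sqr /dot (bigD1 K) //= !mxE !XK -expr2 lerDl.
  by apply: sumr_ge0 => i _; rewrite -expr2 sqr_ge0.
have [t tmin] := strongly_convex1_min (divr_gt0 sigma0 (ltr0n R 2)) Gsc.
exists (X t); split=> [i ki|y yx0]; first exact: Xx0.
apply: le_trans (tmin (y K ord0)) _; apply: (XP _).2 => i /split_le[->|ki].
  by rewrite mxE eqxx.
by rewrite mxE ifN ?yx0 //; apply: contraTneq ki => ->; rewrite ltnn.
Qed.

Lemma strongly_convex_min {n} {sigma : R} {f : 'cV[R]_n -> R} :
  0 < sigma -> strongly_convex sigma f -> exists x, forall y, f x <= f y.
Proof.
move=> sigma0 fsc.
have [x [_ xmin]] := strongly_convex_slice_min sigma0 fsc n 0.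
by exists x => y; apply: xmin => i; rewrite leqNgt ltn_ord.
Qed.

(* Comparing with the midpoint of x and y gives sigma / 4; the optimal
   sigma / 2 would require letting y tend to x along the segment. *)
Lemma strongly_convex_growth {n} {sigma : R} {f : 'cV[R]_n -> R} {x} :
  strongly_convex sigma f -> (forall y, f x <= f y) ->
  forall y, f x + sigma / 4 * dot (y - x) (y - x) <= f y.
Proof.
move=> fsc xmin y; have := fsc y x (1 / 2) ltac:(lra).
have := xmin (2^-1 *: y + (1 - 2^-1) *: x); rewrite !mul1r enorm_sqr.
lra.
Qed.

Lemma strongly_convex_tilt {n} {sigma : R} {f : 'cV[R]_n -> R} (v : 'cV[R]_n) :
  strongly_convex sigma f -> strongly_convex sigma (fun x => f x - dot v x).
Proof.
move=> fsc x y s s01; have := fsc x y s s01; rewrite dotDr !dotZr.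
lra.
Qed.

End Minimizer.

(** * Conjugate and gradient *)

Section Gradient.
Context {R : realType}.

(** The codomain [R^o] and the swapped arguments make this a linear map that can serve as a
    differential. *)
Definition dotr {n} (x y : 'cV[R]_n) : R^o := dot y x.

Lemma dotr_is_linear {n} (x : 'cV[R]_n) : linear (dotr x).
Proof. by move=> a u v; rewrite /dotr dotDl dotZl. Qed.

HB.instance Definition _ n x :=
  GRing.isLinear.Build R 'cV[R]_n R^o _ (dotr x) (dotr_is_linear x).

Lemma cvg_dot {T : Type} {F : set_system T} {FF : Filter F} {n}
    {g h : T -> 'cV[R]_n} {x y : 'cV[R]_n} :
  g @ F --> x -> h @ F --> y -> dot (g t) (h t) @[t --> F] --> dot x y.
Proof.
move=> gx hy; rewrite /dot.
apply: cvg_big => [|i _]; first exact: add_continuous.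
by apply: cvgM; apply: (continuous_cvg _ (@coord_continuous _ _ _ _ _ _)).
Qed.

Lemma dotr_continuous {n} (x : 'cV[R]_n) : continuous (dotr x).
Proof.
move=> y.
exact: (@cvg_dot _ _ (nbhs_filter y) _ id (cst x) y x cvg_id (cvg_cst x)).
Qed.

(** A quadratic remainder is of smaller order than [w - v], so uniqueness of the differential
    identifies it with [dotr x]. *)
Lemma gradient_quadratic {n} {phi : 'cV[R]_n -> \bar R} {v x : 'cV[R]_n}
    {C : R} :
  0 <= C -> (forall w, `|fine (phi w) - fine (phi v) - dot (w - v) x|
     <= C * `|w - v| ^+ 2) ->
  gradient phi v = x.
Proof.
move=> C0 quad; apply/matrixP => i j; rewrite ord1 mxE.
rewrite (@diff_unique _ _ _ (fine \o phi) (dotr x)).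
- exact: dot_delta_mx.
- exact: dotr_continuous.
apply/eqaddoP => e e0.
have C1 : 0 < C + 1 by rewrite ltr_wpDl.
near=> w.
have := quad (w + v); rewrite addrK.
rewrite /= opprD addrA => /le_trans; apply.
have wle : `|w| * (C + 1) <= e.
  rewrite -ler_pdivlMr //; near: w.
  by apply: (@nbhs0_le R 'cV[R]_n); rewrite divr_gt0.
apply: (@le_trans _ _ (`|w| * (C + 1) * `|w|)).
  have : 0 <= `|w| * `|w| by rewrite mulr_ge0.
  rewrite expr2; nra.
by rewrite ler_wpM2r.
Unshelve. all: by end_near. Qed.

Lemma conjugateE {n} {f : 'cV[R]_n -> R} {v x : 'cV[R]_n} :
  (forall y, dot v y - f y <= dot v x - f x) ->
  conjugate f v = (dot v x - f x)%:E.
Proof.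
move=> xmax; apply/eqP; rewrite eq_le; apply/andP; split.
  by apply: ge_ereal_sup => _ [y _ <-]; rewrite lee_fin.
by apply: ereal_sup_ubound; exists x.
Qed.

Lemma conjugate_ge {n} (f : 'cV[R]_n -> R) (v x : 'cV[R]_n) :
  ((dot v x - f x)%:E <= conjugate f v)%E.
Proof. by apply: ereal_sup_ubound; exists x. Qed.

Definition sharp_maximizer {n} (sigma : R) (f : 'cV[R]_n -> R)
    (v x : 'cV[R]_n) :=
  forall y, dot v y - f y <= dot v x - f x - sigma / 4 * dot (y - x) (y - x).

Lemma sharp_maximizer_max {n} {sigma : R} {f : 'cV[R]_n -> R} {v x : 'cV[R]_n} :
  0 < sigma -> sharp_maximizer sigma f v x ->
  forall y, dot v y - f y <= dot v x - f x.
Proof.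
move=> sigma0 xmax y; apply: le_trans (xmax y) _.
by rewrite lerBlDr lerDl mulr_ge0 ?dot_ge0 // divr_ge0 // ltW.
Qed.

Lemma conjugate_maximizer {n} {sigma : R} {f : 'cV[R]_n -> R} (v : 'cV[R]_n) :
  0 < sigma -> strongly_convex sigma f ->
  exists x, sharp_maximizer sigma f v x.
Proof.
move=> sigma0 /(strongly_convex_tilt v) fsc.
have [x xmin] := strongly_convex_min sigma0 fsc.
exists x => y; have := strongly_convex_growth fsc xmin y.
lra.
Qed.

(** The lower bound tests the maximiser [y] for [w] against [x]. The upper bound plays the sharp gap
    at [x] against Young's inequality with [a = sigma / 4], leaving [(4 * a)^-1 = sigma^-1]. *)
Lemma conjugate_quadratic {n} {sigma : R} {f : 'cV[R]_n -> R} {v x : 'cV[R]_n} :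
  0 < sigma -> strongly_convex sigma f ->
  sharp_maximizer sigma f v x ->
  forall w, `|fine (conjugate f w) - fine (conjugate f v) - dot (w - v) x|
    <= sigma^-1 * dot (w - v) (w - v).
Proof.
move=> sigma0 fsc xmax w; have [y ymax] := conjugate_maximizer w sigma0 fsc.
have s4 : 0 < sigma / 4 by rewrite divr_gt0.
rewrite (conjugateE (sharp_maximizer_max sigma0 ymax)).
rewrite (conjugateE (sharp_maximizer_max sigma0 xmax)).
rewrite /= !dotBl ger0_norm.
  have := xmax y; have := dot_le_quadratic (w - v) (y - x) s4.
  have -> : 4 * (sigma / 4) = sigma by field.
  rewrite !dotBl !dotBr.
  lra.
have := sharp_maximizer_max sigma0 ymax x; lra.
Qed.

Lemma gradient_conjugate {n} {sigma : R} {f : 'cV[R]_n -> R} {v x : 'cV[R]_n} :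
  0 < sigma -> strongly_convex sigma f ->
  sharp_maximizer sigma f v x ->
  gradient (conjugate f) v = x.
Proof.
move=> sigma0 fsc xmax; have [C C0 CP] := dot_mulmx_le_norm (1%:M : 'M[R]_n).
apply: (@gradient_quadratic _ _ _ _ (sigma^-1 * C)).
  by rewrite mulr_ge0 // ltW ?invr_gt0.
move=> w; apply: le_trans (conjugate_quadratic sigma0 fsc xmax w) _.
by rewrite -mulrA ler_pM2l ?invr_gt0 //; have := CP (w - v); rewrite mul1mx.
Qed.

End Gradient.

(** * Subdifferentials *)

Section Subdiff.
Context {R : realType}.

(** Along the ray the difference quotient is at most [(c - dot v d) / enorm d], so a nonnegative
    lower limit excludes [c < dot v d]. *)
Lemma regular_subdiff_direction {n} {f : 'cV[R]_n -> R} {x v d : 'cV[R]_n}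
    {c : R} :
  regular_subdiff (EFin \o f) x v -> d != 0 ->
  (\forall t \near 0^'+, f (x + t *: d) <= f x + t * c) -> dot v d <= c.
Proof.
move=> [_]; rewrite limf_einfE => lim_ge0 d0 fd.
rewrite leNgt; apply/negP => cd; have nd := enorm_gt0 d0.
have e0 : (c - dot v d) / enorm d < 0 by rewrite pmulr_llt0 ?invr_gt0 ?subr_lt0.
have : (((c - dot v d) / enorm d)%:E < 0)%E by rewrite lte_fin.
(* The lower limit is a supremum of infima over punctured neighbourhoods, so some [V] keeps all
   quotients above the negative bound. *)
move=> /lt_le_trans /(_ lim_ge0) /ereal_sup_gt[_ [V Vx <-] Vgt].
have Vt : \forall t \near 0^'+, V (x + t *: d).
  have : x + t *: d @[t --> 0^'+] --> x.
    have -> : nbhs x = nbhs (x + 0 *: d) by rewrite scale0r addr0.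
    apply: cvgD; [exact: cvg_cst|apply: cvgZr_tmp].
    exact/cvg_at_right_filter/cvg_id.
  move=> /(_ _ Vx) xV; near=> t.
  have t0 : 0 < t by near: t; exact: nbhs_right_gt.
  suff : x + t *: d != x -> V (x + t *: d).
    by apply; rewrite -subr_eq0 addrC addKr scaler_eq0 gt_eqF.
  by near: t; exact: xV.
suff /filter_ex[] : \forall t \near (0 : R)^'+, False by [].
near=> t; have t0 : 0 < t by near: t; exact: nbhs_right_gt.
have Vxt : V (x + t *: d) by near: t.
have fxt : f (x + t *: d) <= f x + t * c by near: t.
have : (((c - dot v d) / enorm d)%:E <
    ((f (x + t *: d) - f x - dot v (t *: d)) / enorm (t *: d))%:E)%E.
  apply: lt_le_trans Vgt _; apply: ereal_inf_lbound; exists (x + t *: d) => //.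
  by rewrite (addrC x) addrK.
rewrite lte_fin dotZr enormZ gtr0_norm // ltNge => /negP; apply.
rewrite invfM mulrA ler_pM2r ?invr_gt0 // ler_pdivrMr //.
lra.
Unshelve. all: by end_near. Qed.

(** Convexity puts [f] below its chord from [x] to [y], so [f y - f x] is an admissible slope in the
    direction [y - x]. *)
Lemma regular_subdiff_convex {n} {sigma : R} {f : 'cV[R]_n -> R}
    {x v : 'cV[R]_n} :
  0 < sigma -> strongly_convex sigma f -> regular_subdiff (EFin \o f) x v ->
  forall y, f x + dot v (y - x) <= f y.
Proof.
move=> sigma0 fsc vx y; have [->|yx] := eqVneq y x.
  by rewrite subrr -(scale0r 0) dotZr mul0r addr0.
rewrite -lerBrDl; apply: (regular_subdiff_direction vx).
  by rewrite subr_eq0.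
near=> t; have t0 : 0 <= t by near: t; exact: nbhs_right_ge.
have t1 : t <= 1 by near: t; exact: nbhs_right_le.
have := fsc y x t ltac:(lra); rewrite enorm_sqr.
have -> : t *: y + (1 - t) *: x = x + t *: (y - x).
  by rewrite scalerBl scale1r scalerBr addrCA.
have : 0 <= sigma / 2 * t * (1 - t) * dot (y - x) (y - x).
  by rewrite !mulr_ge0 ?dot_ge0 ?invr_ge0; lra.
lra.
Unshelve. all: by end_near. Qed.

Lemma limiting_subdiff_convex {n} {sigma : R} {f : 'cV[R]_n -> R}
    {x v : 'cV[R]_n} :
  0 < sigma -> strongly_convex sigma f -> limiting_subdiff (EFin \o f) x v ->
  forall y, f x + dot v (y - x) <= f y.
Proof.
move=> sigma0 fsc [_ [xk [vk [xkx fxk vkxk vkv]]]] y.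
have fx : f (xk k) @[k --> \oo] --> f x by exact: (fine_cvg fxk).
have yxk : y - xk k @[k --> \oo] --> y - x by apply: cvgB => //; exact: cvg_cst.
apply: (cvgr_to_le (cvgD fx (cvg_dot vkv yxk))).
by near=> k; apply: regular_subdiff_convex sigma0 fsc (vkxk k) y.
Unshelve. all: by end_near. Qed.

Lemma step_costE {m} (lambda : R) (u : 'cV[R]_m) :
  step_cost lambda u = \sum_(i < m) lambda * (0 < u i ord0)%R%:R.
Proof.
rewrite /step_cost mulr_sumr; apply: eq_bigr => i _.
rewrite indicE; congr (_ * _%:R).
by congr nat_of_bool; apply/idP/idP; rewrite inE /= in_itv /= andbT.
Qed.

(** Lowering a coordinate never raises the cost, whence [v i >= 0]; away from zero a small increase
    leaves the cost unchanged, whence [v i <= 0]. *)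
Lemma regular_subdiff_step_cost {m} {lambda : R} {u v : 'cV[R]_m} :
  0 < lambda -> regular_subdiff (EFin \o step_cost lambda) u v ->
  forall i, 0 <= v i ord0 /\ (u i ord0 != 0 -> v i ord0 = 0).
Proof.
move=> lambda0 vu i.
have delta0 : delta_mx i ord0 != 0 :> 'cV[R]_m.
  apply/eqP => /matrixP/(_ i ord0); rewrite !mxE !eqxx => /eqP.
  by rewrite oner_eq0.
have v0 : 0 <= v i ord0.
  rewrite -oppr_le0 -dot_delta_mx dotC -dotNr.
  apply: (regular_subdiff_direction vu); first by rewrite oppr_eq0.
  near=> t; have t0 : 0 < t by near: t; exact: nbhs_right_gt.
  rewrite mulr0 addr0 !step_costE; apply: ler_sum => j _.
  rewrite ler_pM2l // ler_nat !mxE.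
  case: (ltP 0 (u j ord0)) => [_|uj]; first exact: leq_b1.
  have : 0 <= t * ((j == i) && true)%:R :> R by rewrite mulr_ge0 // ltW.
  by rewrite eqxx mulrN leqn0 eqb0 -leNgt; lra.
split=> // ui0; apply/eqP; rewrite eq_le v0 andbT -dot_delta_mx dotC.
apply: (regular_subdiff_direction vu) => //.
near=> t; rewrite mulr0 addr0 !step_costE le_eqVlt; apply/orP; left; apply/eqP.
apply: eq_bigr => j _; rewrite !mxE; have [->|] := eqVneq j i; last first.
  by rewrite mulr0 addr0.
rewrite !eqxx mulr1; congr (_ * (nat_of_bool _)%:R).
have t0 : 0 < t by near: t; exact: nbhs_right_gt.
have : t < `|u i ord0| by near: t; apply: nbhs_right_lt; rewrite normr_gt0.
have [ui|ui|ui] := ltgtP (u i ord0) 0; last by move: (ui0); rewrite ui eqxx.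
  by rewrite ltr0_norm // => tu; apply/negbTE; rewrite -leNgt; lra.
by rewrite addr_gt0.
Unshelve. all: by end_near. Qed.

(** The sign condition is closed, and a nonzero [u i] stays nonzero along the tail of [uk], where it
    forces [zk] to vanish at [i]. *)
Lemma limiting_subdiff_step_cost {m} {lambda : R} {u z : 'cV[R]_m} :
  0 < lambda -> limiting_subdiff (EFin \o step_cost lambda) u z ->
  forall i, 0 <= z i ord0 /\ (u i ord0 != 0 -> z i ord0 = 0).
Proof.
move=> lambda0 [_ [uk [zk [uku _ zkuk zkz]]]] i.
have cvg_coord (w : nat -> 'cV[R]_m) (l : 'cV[R]_m) : w k @[k --> \oo] --> l ->
    w k i ord0 @[k --> \oo] --> l i ord0.
  by move=> wl; apply: (continuous_cvg _ (@coord_continuous _ _ _ _ _ _)).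
have zi := cvg_coord _ _ zkz.
have zi0 : 0 <= z i ord0.
  apply: (cvgr_to_ge zi).
  by near=> k; exact: (regular_subdiff_step_cost lambda0 (zkuk k) i).1.
split=> // ui0; have uki0 := cvgr_neq0 _ (cvg_coord _ _ uku) ui0.
suff : z i ord0 <= 0 by lra.
apply: (cvgr_to_le zi).
near=> k; rewrite (regular_subdiff_step_cost lambda0 (zkuk k) i).2 //.
near: k; exact: uki0.
Unshelve. all: by end_near. Qed.

End Subdiff.

(** * Duality *)

Lemma near_coord {R : realType} {m} {z : 'cV[R]_m} {P : 'I_m -> R -> Prop} :
  (forall i, \forall t \near z i ord0, P i t) ->
  \forall y \near z, forall i, P i ((y : 'cV[R]_m) i ord0).
Proof.
move=> zP; have zP' i : \forall y \near z, P i ((y : 'cV[R]_m) i ord0).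
  exact: (coord_continuous (zP i)).
exact: (@filter_forall _ _ _ _ (nbhs_filter z) zP').
Qed.

(** Keeps the linear term of one coordinate below a jump of height [mu] or [lambda]. *)
Lemma near_mulB_lt {R : realType} {a c e : R} : 0 < e ->
  \forall t \near a, (t - a) * c < e.
Proof.
have a0 : (t - a) * c @[t --> a] --> (a - a) * c.
  by apply: cvgMr_tmp; apply: cvgB; [exact: cvg_id|exact: cvg_cst].
by rewrite subrr mul0r in a0; exact: cvgr_lt a0 e.
Qed.

Section Duality.
Context {R : realType} {n m : nat} {f : 'cV[R]_n -> R} {sigma : R}.
Context {A : 'M[R]_(m, n)} {b : 'cV[R]_m} {lambda mu : R}.
Context (sigma_gt0 : 0 < sigma) (f_sc : strongly_convex sigma f).

Lemma conjugate_fin_num v : conjugate f v \is a fin_num.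
Proof.
have [x xmax] := conjugate_maximizer v sigma_gt0 f_sc.
by rewrite (conjugateE (sharp_maximizer_max sigma_gt0 xmax)).
Qed.

Lemma dot_mulNtrmx (z : 'cV[R]_m) (x : 'cV[R]_n) :
  dot (- A^T *m z) x = - dot z (A *m x).
Proof. by rewrite mulNmx dotNl dot_trmx. Qed.

Lemma l0normE (z : 'cV[R]_m) :
  mu * (l0norm z)%:R = \sum_(i < m) mu * (z i ord0 != 0)%R%:R.
Proof.
rewrite /l0norm -sum1_card natr_sum mulr_sumr [LHS]big_mkcond.
by apply: eq_bigr => i _; rewrite inE; case: (z i ord0 != 0); rewrite ?mulr0.
Qed.

Lemma dual_objectiveE (z : 'cV[R]_m) :
  (forall i, 0 <= z i ord0) ->
  dual_objective f A b mu z =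
    (fine (conjugate f (- A^T *m z)) - dot b z + mu * (l0norm z)%:R)%:E.
Proof.
move=> z0; rewrite /dual_objective /dual_h /dual_g /delta_plus.
rewrite ifT; last exact/forallP.
by rewrite -[in LHS](fineK (conjugate_fin_num _)) adde0.
Qed.

Lemma dual_objective_pinfty (z : 'cV[R]_m) :
  ~ (forall i, 0 <= z i ord0) -> dual_objective f A b mu z = +oo%E.
Proof.
move=> z0; rewrite /dual_objective /dual_h /dual_g /delta_plus.
rewrite ifF; last by apply/negP => /forallP.
by rewrite -[in LHS](fineK (conjugate_fin_num _)).
Qed.

Lemma dual_local_minimizer {x : 'cV[R]_n} {u z : 'cV[R]_m} :
  0 < mu ->
  (forall y, f x + dot (- A^T *m z) (y - x) <= f y) ->
  A *m x + b = u ->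
  (forall i, 0 <= z i ord0 /\ (u i ord0 != 0 -> z i ord0 = 0)) ->
  local_minimizer [set: 'cV[R]_m] (dual_objective f A b mu) z.
Proof.
move=> mu0 subgrad uE comp; have z0 i := (comp i).1.
split=> //; first by rewrite dual_objectiveE // ltry.
have near_z : \forall y \near z, forall i,
    (z i ord0 != 0 -> (y : 'cV[R]_m) i ord0 != 0) /\
    (y i ord0 - z i ord0) * u i ord0 < mu.
  apply: (@near_coord _ _ _ (fun i t => (z i ord0 != 0 -> t != 0) /\
    (t - z i ord0) * u i ord0 < mu)) => i.
  apply: filterI; last exact: near_mulB_lt.
  have [zi|zi] := eqVneq (z i ord0) 0.
    by apply: filterE => t; rewrite ?zi ?eqxx.
  by apply: filterS (cvgr_neq0 _ cvg_id zi) => t t0 _.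
near=> y => _; have [y0|y0] := pselect (forall i, 0 <= y i ord0); last first.
  by rewrite (dual_objective_pinfty _ y0) leey.
rewrite !dual_objectiveE // lee_fin.
(* Fenchel's inequality is an equality at [z], by the subgradient hypothesis; subtracting it from
   the inequality at [y] leaves the linear term [dot (y - z) u]. *)
have -> : conjugate f (- A^T *m z) = (dot (- A^T *m z) x - f x)%:E.
  by apply: conjugateE => w; have := subgrad w; rewrite dotBr; lra.
have : dot (- A^T *m y) x - f x <= fine (conjugate f (- A^T *m y)).
  by rewrite -lee_fin fineK ?conjugate_fin_num // conjugate_ge.
rewrite /= !dot_mulNtrmx !(dotC b).
suff : dot (y - z) u <= mu * (l0norm y)%:R - mu * (l0norm z)%:R.
  by rewrite -uE dotBl !dotDr; lra.
rewrite !l0normE -sumrB; apply: ler_sum => i _; rewrite !mxE.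
have near_zy : forall i, (z i ord0 != 0 -> y i ord0 != 0) /\
    (y i ord0 - z i ord0) * u i ord0 < mu by near: y.
(* If [z i = 0], leaving zero costs [mu], more than the linear gain; otherwise [u i = 0] and
   coordinate [i] stays in the support. *)
have [zy yu] := near_zy i; have [zi|zi] := eqVneq (z i ord0) 0.
  have [yi|yi] := eqVneq (y i ord0) 0; first by rewrite zi yi; lra.
  by move: yu; rewrite mulr0 mulr1; lra.
have -> : u i ord0 = 0 by apply/eqP; apply: contraNT zi => /(comp i).2 ->.
by rewrite zy // mulr0; lra.
Unshelve. all: by end_near. Qed.

Lemma fine_dual_h (z : 'cV[R]_m) :
  fine (dual_h f A b z) = fine (conjugate f (- A^T *m z)) - dot b z.
Proof. by rewrite /dual_h -(fineK (conjugate_fin_num _)). Qed.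

(** The quadratic estimate for the conjugate is composed with [- A^T]; the linear term in [b] leaves
    no remainder. *)
Lemma gradient_dual_h {z : 'cV[R]_m} {x : 'cV[R]_n} :
  sharp_maximizer sigma f (- A^T *m z) x ->
  gradient (dual_h f A b) z = - (A *m x + b).
Proof.
move=> xmax; have [C C0 CP] := dot_mulmx_le_norm (- A^T).
apply: (@gradient_quadratic _ _ _ _ _ (sigma^-1 * C)).
  by rewrite mulr_ge0 // ltW ?invr_gt0.
move=> w; have := conjugate_quadratic sigma_gt0 f_sc xmax (- A^T *m w).
rewrite -mulmxBr dot_mulNtrmx.
rewrite !fine_dual_h; set p := fine _; set q := fine _.
have -> : p - dot b w - (q - dot b z) - dot (w - z) (- (A *m x + b)) =
    p - q - - dot (w - z) (A *m x).
  by rewrite dotNr dotDr [dot (w - z) b]dotBl !(dotC b); ring.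
by move=> /le_trans; apply; rewrite -mulrA ler_pM2l ?invr_gt0.
Qed.

(** A positive [z i] can move both ways without changing sign or support, so only the smooth part
    varies along [d], with slope [- u i]. *)
Lemma dual_local_minimizer_stationary {z : 'cV[R]_m} {x : 'cV[R]_n} :
  sharp_maximizer sigma f (- A^T *m z) x ->
  local_minimizer [set: 'cV[R]_m] (dual_objective f A b mu) z ->
  forall i, 0 <= z i ord0 /\ (z i ord0 != 0 -> (A *m x + b) i ord0 = 0).
Proof.
move=> xmax [_ Fz zmin].
have z0 : forall i, 0 <= z i ord0.
  by apply: contrapT => /dual_objective_pinfty Fzoo; rewrite Fzoo ltxx in Fz.
move=> i; split=> // zi0.
have zi : 0 < z i ord0 by rewrite lt_neqAle eq_sym zi0 z0.
set u := A *m x + b; pose d : 'cV[R]_m := delta_mx i ord0.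
pose K := sigma^-1 * dot (- A^T *m d) (- A^T *m d).
have ray : z + t *: d @[t --> 0] --> z.
  have -> : nbhs z = nbhs (z + (0 : R) *: d) by rewrite scale0r addr0.
  by apply: cvgD; [exact: cvg_cst|apply: cvgZr_tmp; exact: cvg_id].
have : \forall t \near (0 : R), t * u i ord0 <= K * t ^+ 2.
  have {}zmin := ray _ zmin.
  near=> t; have /(_ I) : [set: 'cV[R]_m] (z + t *: d) ->
      (dual_objective f A b mu z <= dual_objective f A b mu (z + t *: d))%E.
    by near: t.
  have tz : - z i ord0 < t.
    by near: t; apply: (cvgr_gt _ (@cvg_id _ (nbhs (0 : R)))); rewrite oppr_lt0.
  have zd j : (z + t *: d) j ord0 = if j == i then z i ord0 + t else z j ord0.
    rewrite !mxE eqxx andbT.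
    by case: eqP => [->|_]; rewrite ?mulr1 ?mulr0 ?addr0.
  have zd0 j : 0 <= (z + t *: d) j ord0.
    by rewrite zd; case: ifP => // _; lra.
  rewrite !dual_objectiveE // lee_fin.
  have -> : l0norm (z + t *: d) = l0norm z.
    apply: eq_card => j; rewrite !inE zd; have [->|//] := eqVneq j i.
    by rewrite zi0; apply/eqP; lra.
  have := conjugate_quadratic sigma_gt0 f_sc xmax (- A^T *m (z + t *: d)).
  rewrite -mulmxBr [z + _ - z]addrC addKr => /(le_trans (ler_norm _)).
  rewrite (dot_mulNtrmx _ x) !(dotC b) dotDl -scalemxAr !(dotZl, dotZr).
  by rewrite !dot_delta_mx /K /u [(A *m x + b) _ _]mxE expr2; lra.
move=> /nbhs_ballP[e /= e0 eK].
apply/eqP; apply: contrapT => /negP; rewrite -normr_gt0 => ui.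
have [s [s0 se sK]] := small_step K ui e0.
(* Giving [t] the sign of [u i] yields [s * |u i| <= K * s ^+ 2], against [s * K < |u i|]. *)
have := eK (s * Num.sg (u i ord0)).
rewrite /ball /= sub0r normrN normrM normr_sg -normr_gt0 ui mulr1 gtr0_norm //.
move=> /(_ se); rewrite -mulrA -normrEsg exprMn sqr_sg -normr_gt0 ui mulr1.
apply/negP; rewrite -ltNge expr2 mulrCA ltr_pM2l // mulrC.
lra.
Unshelve. all: by end_near. Qed.

Lemma primal_local_minimizer {x : 'cV[R]_n} {z : 'cV[R]_m} :
  0 < lambda ->
  (forall y, f x + dot (- A^T *m z) (y - x) <= f y) ->
  (forall i, 0 <= z i ord0 /\ (z i ord0 != 0 -> (A *m x + b) i ord0 = 0)) ->
  local_minimizer (primal_feasible A b) (primal_objective f lambda)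
    (x, A *m x + b).
Proof.
move=> lambda0 subgrad comp; set u := A *m x + b.
split=> //; first by rewrite /primal_objective ltry.
have near_u : \forall w \near u, forall i,
    (0 < u i ord0 -> 0 < (w : 'cV[R]_m) i ord0) /\
    (w i ord0 - u i ord0) * z i ord0 < lambda.
  apply: (@near_coord _ _ _ (fun i t => (0 < u i ord0 -> 0 < t) /\
    (t - u i ord0) * z i ord0 < lambda)) => i.
  apply: filterI; last exact: near_mulB_lt.
  have [ui|ui] := leP (u i ord0) 0; first by apply: filterE.
  by apply: filterS (cvgr_gt _ cvg_id _ ui) => t t0 _.
near=> p => yw.
have near_uw : forall i, (0 < u i ord0 -> 0 < p.2 i ord0) /\
    (p.2 i ord0 - u i ord0) * z i ord0 < lambda.
  by near: p; exact: (cvg_snd near_u).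
have {}yw : A *m p.1 + b = p.2 by [].
rewrite /primal_objective lee_fin /=; have := subgrad p.1.
move: p.1 p.2 near_uw yw => y w near_uw yw.
suff : dot z (w - u) <= step_cost lambda w - step_cost lambda u.
  by rewrite dot_mulNtrmx mulmxBr -yw /u !dotBr !dotDr; lra.
rewrite !step_costE -sumrB; apply: ler_sum => i _.
rewrite [(w - u) _ _]mxE [(- u) _ _]mxE mulrC.
have [uw wz] := near_uw i; have [zi0 ziu] := comp i.
(* If [z i = 0], the cost cannot drop, as positive entries stay positive. Otherwise [u i = 0]:
   either [w i > 0] pays [lambda], or [w i <= 0] makes the product nonpositive. *)
have [zi|zi] := eqVneq (z i ord0) 0.
  rewrite zi mulr0 -mulrBr pmulr_rge0 // subr_ge0 ler_nat.
  by case: (ltP 0 (u i ord0)) uw => // _ -> //.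
rewrite -/u in ziu; move: wz; rewrite ziu // ltxx mulr0 !subr0.
case: (ltP 0 (w i ord0)) => [_|wi]; first by rewrite mulr1; exact: ltW.
by move=> _; rewrite mulr0 mulr_le0_ge0.
Unshelve. all: by end_near. Qed.

End Duality.

Theorem theorem10 (R : realType) (n m : nat) (f : 'cV[R]_n -> R)
    (sigma_f : R) (A : 'M[R]_(m, n)) (b : 'cV[R]_m) (lambda mu : R)
    (sigma_f_gt0 : 0 < sigma_f) (f_sc : strongly_convex sigma_f f)
    (lambda_gt0 : 0 < lambda) (mu_gt0 : 0 < mu) :
  (forall (x : 'cV[R]_n) (u z : 'cV[R]_m),
     local_minimizer (primal_feasible A b) (primal_objective f lambda) (x, u) ->
     associated_multiplier f A b lambda x u z ->
     local_minimizer [set: 'cV[R]_m] (dual_objective f A b mu) z)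
  /\
  (forall z : 'cV[R]_m,
     local_minimizer [set: 'cV[R]_m] (dual_objective f A b mu) z ->
     local_minimizer (primal_feasible A b) (primal_objective f lambda)
       (gradient (conjugate f) (- A^T *m z), - gradient (dual_h f A b) z)).
Proof.
split=> [x u z _ [[v vx vz] zu xu]|z zmin].
  apply: (dual_local_minimizer sigma_f_gt0 f_sc mu_gt0 (x := x) (u := u)).
  - rewrite mulNmx -(addr0_eq vz) opprK.
    exact: limiting_subdiff_convex sigma_f_gt0 f_sc vx.
  - by apply/eqP; rewrite -subr_eq0 xu.
  - exact: limiting_subdiff_step_cost lambda_gt0 zu.
(* The pair of gradients is [(x, A *m x + b)], with [x] the maximiser for [- A^T *m z]. *)
have [x xmax] := conjugate_maximizer (- A^T *m z) sigma_f_gt0 f_sc.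
rewrite (gradient_conjugate sigma_f_gt0 f_sc xmax).
rewrite (gradient_dual_h sigma_f_gt0 f_sc xmax) opprK.
apply: (primal_local_minimizer lambda_gt0 (z := z)).
  move=> y; rewrite dotBr.
  by have := sharp_maximizer_max sigma_f_gt0 xmax y; lra.
exact: (dual_local_minimizer_stationary sigma_f_gt0 f_sc xmax zmin).
Qed.
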